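(* Let $n,s$ be integers with $s\ge 10$ and $n\le 3s$. If $\mathcal F\subset\binom{[n]}{3}$ has property $U(s,2s+1)$, i.e. $|F_1\cup\ldots\cup F_s|\le 2s+1$ for all $F_1,\ldots,F_s\in\mathcal F$, then $|\mathcal F|\le\binom{2s+1}{3}$.
   Context: $\binom{[n]}{3}$ is the set of $3$-subsets of $[n]=\{1,\ldots,n\}$; the sets $F_i$ need not be distinct. The bound $\binom{2s+1}{3}$ is the size of the family $\mathcal A(2s+1,3,n,3)=\{A\in\binom{[n]}{3}:|A\cap[2s+1]|\ge 3\}$. *)

(* Defs.v *)
From mathcomp Require Import all_boot.
Set Implicit Arguments.
Unset Strict Implicit.
Unset Printing Implicit Defensive.

(* The ground set [n] = {1, ..., n} is represented by 'I_n = {0, ..., n-1}. *)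

Definition ksubsets (n k : nat) : {set {set 'I_n}} :=
  [set A : {set 'I_n} | #|A| == k].

(* The s-tuple (F_1, ..., F_s) is a function G, not required to be injective. *)
Definition propertyU (n : nat) (F : {set {set 'I_n}}) (s q : nat) : Prop :=
  forall G : 'I_s -> {set 'I_n},
    (forall i, G i \in F) -> #|\bigcup_(i < s) G i| <= q.

(* Main.v *)
(** Compression (replacing [j] by [i < j]) preserves [U(s, q)] and the size of
    the family, so the family may be assumed shifted.  Let [q = 2s+1].  If a
    shifted family has a member reaching [q] or beyond, it contains [{0,1,q}].
    - If [{1,2,q}] is a member, it cannot be completed to a cover of [{0..q}] by
      the [s-1] triples [{0, 2+i, q-i}], so one of these is missing.
    - Otherwise every member reaching [q] contains [0].  Either [{2,3,4}] is
      missing, and all members meet [{0,1}], or [{0,1,q}] and [{2,3,4}] cannot be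
      completed to a cover of [{0..q}] by the [s-2] triples [{0, 4+i, q-i}], so
      one of these is missing.
    Shiftedness turns one missing triple into a bound on the whole family, and
    the resulting cubics in [i] stay below ['C(q, 3)]. *)

Require Import Defs.
From mathcomp Require Import all_boot.
From mathcomp Require Import zify.
Set Implicit Arguments.
Unset Strict Implicit.
Unset Printing Implicit Defensive.

(** * Compression of set families and reduction to shifted families *)

Definition exchange (T : finType) (i j : T) (A : {set T}) : {set T} :=
  i |: (A :\ j).

Lemma exchangeK (T : finType) (i j : T) (A : {set T}) :
  j \in A -> i \notin A -> exchange j i (exchange i j A) = A.
Proof.
move=> jA iA; rewrite /exchange setU1K ?setD1K //.
by rewrite !inE negb_and iA orbT.
Qed.

Lemma card_exchange (T : finType) (i j : T) (A : {set T}) :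
  j \in A -> i \notin A -> #|exchange i j A| = #|A|.
Proof.
by move=> jA iA; rewrite cardsU1 (cardsD1 j A) jA !inE negb_and iA orbT.
Qed.

Definition shift_elt (T : finType) (F : {set {set T}}) (i j : T) (A : {set T}) :=
  if [&& j \in A, i \notin A & exchange i j A \notin F]
  then exchange i j A else A.

Definition shift (T : finType) (i j : T) (F : {set {set T}}) : {set {set T}} :=
  shift_elt F i j @: F.

(** A moved set lands outside [F], so it cannot collide with one that stays; two moved sets are told
    apart by exchanging back. *)
Lemma shift_elt_inj (T : finType) (F : {set {set T}}) (i j : T) :
  {in F &, injective (shift_elt F i j)}.
Proof.
move=> A B AF BF; rewrite /shift_elt.
case: ifP => [/and3P[jA iA eA]|_]; case: ifP => [/and3P[jB iB eB]|_] //.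
- by move=> e; rewrite -(exchangeK jA iA) e exchangeK.
- by move=> e; rewrite e BF in eA.
- by move=> e; rewrite -e AF in eB.
Qed.

Lemma card_shift (T : finType) (F : {set {set T}}) (i j : T) :
  #|shift i j F| = #|F|.
Proof. exact/card_in_imset/shift_elt_inj. Qed.

(** A member of the shifted family that still has [j] and lacks [i] was left in place, which happens
    only if its exchange was already in [F]. *)
Lemma shift_exchange (T : finType) (F : {set {set T}}) (i j : T) (A : {set T}) :
  A \in shift i j F -> j \in A -> i \notin A -> exchange i j A \in F.
Proof.
move=> /imsetP[B BF ->]; rewrite /shift_elt.
case: ifP => [_ _|H jB iB]; first by rewrite !inE eqxx.
by move: H; rewrite jB iB /= => /negbFE.
Qed.

Lemma shift_notin (T : finType) (F : {set {set T}}) (i j : T) (A : {set T}) :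
  A \in shift i j F -> A \notin F ->
  [/\ i \in A, j \notin A & exchange j i A \in F].
Proof.
move=> /imsetP[B BF ->]; rewrite /shift_elt.
case: ifP => [/and3P[jB iB eB] _|_]; last by rewrite BF.
split; [by rewrite !inE eqxx| | by rewrite exchangeK].
by rewrite !inE negb_or eqxx /= andbT; apply: contraNneq iB => <-.
Qed.

Lemma propertyU_shift (n : nat) (F : {set {set 'I_n}}) (s q : nat)
    (i j : 'I_n) :
  propertyU F s q -> propertyU (shift i j F) s q.
Proof.
move=> FU G GS; case: (boolP [forall l, G l \in F]) => [/forallP|].
  exact: FU.
rewrite negb_forall => /existsP[l0 Gl0].
have [il0 jl0 el0] := shift_notin (GS l0) Gl0.
have ij : i != j by apply: contraNneq jl0 => <-.
(* Undo the exchange on the sets outside [F]; this covers [j] but may lose [i],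
   which is recovered by exchanging [j] for [i] in the sets containing [j]. *)
pose H l := if G l \in F then
    if (j \in G l) && (i \notin G l) then exchange i j (G l) else G l
  else exchange j i (G l).
have HF l : H l \in F.
  rewrite /H; case: ifPn => [GF|GF]; last by case: (shift_notin (GS l) GF).
  case: ifP => // /andP[jG iG]; exact: shift_exchange (GS l) jG iG.
apply: leq_trans (FU H HF).
have jH : j \in \bigcup_l H l.
  by apply/bigcupP; exists l0 => //; rewrite /H (negbTE Gl0) !inE eqxx.
have sub x : x != i -> x != j -> x \in \bigcup_l G l -> x \in \bigcup_l H l.
  move=> xi xj /bigcupP[l _ xG]; apply/bigcupP; exists l => //.
  by rewrite /H; do ![case: ifP => _]; rewrite // !inE ?(negbTE xi) ?(negbTE xj).
have iU : i \in \bigcup_l G l by apply/bigcupP; exists l0.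
case: (boolP (j \in \bigcup_l G l)) => [/bigcupP[l _ jG]|jU].
  apply/subset_leq_card/subsetP => x xU.
  case: (eqVneq x j) => [->//|xj]; case: (eqVneq x i) => [->|xi]; last exact: sub.
  apply/bigcupP; exists l => //; rewrite /H; case: ifPn => [GF|GF].
    by case: ifP => [_|]; rewrite ?inE ?eqxx // jG => /negbFE.
  by have [_] := shift_notin (GS l) GF; rewrite jG.
(* No [G l] contains [j] here, so [i] may really be lost; but [j] is gained, and the union of [H]
   contains the union of [G] with [i] replaced by [j], a set of the same size. *)
rewrite -(card_exchange iU jU); apply/subset_leq_card/subsetP => x.
rewrite !inE => /orP[/eqP->//|/andP[xi xU]].
by apply: sub => //; apply: contraNneq jU => <-.
Qed.

(** Termination measure for compression: every shift that moves some member down lowers it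
    strictly. *)
Definition weight (n : nat) (F : {set {set 'I_n}}) : nat :=
  \sum_(A in F) \sum_(x in A) x.

Lemma sum_exchange (n : nat) (i j : 'I_n) (A : {set 'I_n}) :
  i < j -> j \in A -> i \notin A ->
  \sum_(x in exchange i j A) x < \sum_(x in A) x.
Proof.
move=> ij jA iA; rewrite big_setU1 /=; last by rewrite !inE negb_and iA orbT.
by rewrite [X in _ < X](big_setD1 j) //= ltn_add2r.
Qed.

Lemma weight_shift (n : nat) (F : {set {set 'I_n}}) (i j : 'I_n) (A : {set 'I_n}) :
  i < j -> A \in F -> j \in A -> i \notin A -> exchange i j A \notin F ->
  weight (shift i j F) < weight F.
Proof.
move=> ij AF jA iA eA; rewrite /weight big_imset /=; last exact: shift_elt_inj.
rewrite (big_setD1 A) //= [X in _ < X](big_setD1 A) //= -addSn.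
apply: leq_add; first by rewrite /shift_elt jA iA eA /= sum_exchange.
apply: leq_sum => B _; rewrite /shift_elt.
by case: ifP => // /and3P[jB iB _]; apply/ltnW/sum_exchange.
Qed.

Definition shifted (n : nat) (F : {set {set 'I_n}}) : Prop :=
  forall (A : {set 'I_n}) (i j : 'I_n),
    A \in F -> i < j -> j \in A -> i \notin A -> exchange i j A \in F.

Lemma shifted_reduction (n k s q : nat) (F : {set {set 'I_n}}) :
  F \subset ksubsets n k -> propertyU F s q ->
  exists F' : {set {set 'I_n}},
    [/\ F' \subset ksubsets n k, propertyU F' s q, shifted F' & #|F'| = #|F|].
Proof.
have [w] := ubnP (weight F); elim: w F => // w IHw F wF Fk FU.
case: (boolP [forall A : {set 'I_n}, forall i : 'I_n, forall j : 'I_n,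
  [&& A \in F, i < j, j \in A & i \notin A] ==> (exchange i j A \in F)]).
  move=> /forallP H; exists F; split => // A i j AF ij jA iA.
  by move: (H A) => /forallP/(_ i)/forallP/(_ j); rewrite AF ij jA iA.
rewrite negb_forall => /existsP[A]; rewrite negb_forall => /existsP[i].
rewrite negb_forall => /existsP[j]; rewrite negb_imply.
move=> /andP[/and4P[AF ij jA iA] eA].
have lt := weight_shift ij AF jA iA eA.
have [|||F' [kF' UF' sF' cF']] := IHw (shift i j F).
- exact: leq_trans lt _.
- apply/subsetP => _ /imsetP[B BF ->]; have := subsetP Fk B BF.
  rewrite !inE /shift_elt; case: ifP => // /and3P[jB iB _].
  by rewrite card_exchange.
- exact: propertyU_shift.
by exists F'; rewrite cF' card_shift.
Qed.

(** * Triples in a shifted family *)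

(** Entries are plain naturals, so positions are compared by arithmetic alone; an entry that is at
    least [n] silently drops out of the set. *)
Definition triple (n a b c : nat) : {set 'I_n} :=
  [set x : 'I_n | [|| x == a :> nat, x == b :> nat | x == c :> nat]].

Lemma ksubsets3P (n : nat) (A : {set 'I_n}) :
  A \in ksubsets n 3 ->
  exists a b c, [/\ a < b, b < c, c < n & A = triple n a b c].
Proof.
rewrite inE => A3.
have [x xA] : exists x, x \in A by apply/card_gt0P; rewrite (eqP A3).
have : #|A :\ x| == 2 by move: A3; rewrite (cardsD1 x) xA.
case/cards2P => y [z [yz eA]].
have xy : x != y.
  have : y \in A :\ x by rewrite eA !inE eqxx.
  by rewrite !inE eq_sym => /andP[].
have xz : x != z.
  have : z \in A :\ x by rewrite eA !inE eqxx orbT.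
  by rewrite !inE eq_sym => /andP[].
have memA u : (u \in A) = [|| u == x, u == y | u == z].
  by rewrite -(setD1K xA) eA !inE.
have lx := ltn_ord x; have ly := ltn_ord y; have lz := ltn_ord z.
rewrite -!val_eqE /= in xy xz yz.
have tri a b c : (forall u : nat, [|| u == a, u == b | u == c] =
    [|| u == x, u == y | u == z]) -> A = triple n a b c.
  by move=> H; apply/setP => u; rewrite memA inE H -!val_eqE.
case: (ltngtP x y) xy => // xy _; case: (ltngtP x z) xz => // xz _;
  case: (ltngtP y z) yz => // yz _; try (exfalso; lia).
- by exists x, y, z; split => //; apply: tri => u; lia.
- by exists x, z, y; split => //; apply: tri => u; lia.
- by exists z, x, y; split => //; apply: tri => u; lia.
- by exists y, x, z; split => //; apply: tri => u; lia.
- by exists y, z, x; split => //; apply: tri => u; lia.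
- by exists z, y, x; split => //; apply: tri => u; lia.
Qed.

Lemma shifted_triple (n : nat) (F : {set {set 'I_n}}) (a b c a' b' c' : nat) :
  shifted F -> triple n a b c \in F -> a < b -> b < c -> c < n ->
  a' <= a -> b' <= b -> c' <= c -> a' < b' -> b' < c' ->
  triple n a' b' c' \in F.
Proof.
move=> sF abcF ab bc cn aa bb cc ab' bc'.
have step i j d e : i < j -> j < n -> i != d -> i != e -> j != d -> j != e ->
    triple n j d e \in F -> triple n i d e \in F.
  move=> ij jn id ie jd je jF.
  have jn' := ltn_trans ij jn.
  have := sF _ (Ordinal jn') (Ordinal jn) jF ij.
  rewrite !inE /= eqxx => /(_ isT).
  have -> : ~~ [|| i == j, i == d | i == e] by lia.
  move=> /(_ isT); congr (_ \in F); apply/setP => x.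
  by rewrite !inE -!val_eqE /=; lia.
have rot d e f : triple n d e f = triple n e f d.
  by apply/setP => x; rewrite !inE; lia.
(* Lowering the smallest entry first, then the middle one, then the largest keeps the three entries
   distinct throughout. *)
have abcF1 : triple n a' b c \in F.
  case: (eqVneq a' a) => [-> //|ne].
  by apply: (step a' a) abcF; lia.
have abcF2 : triple n b' c a' \in F.
  move: abcF1; rewrite rot; case: (eqVneq b' b) => [-> //|ne].
  by apply: (step b' b); lia.
move: abcF2; rewrite rot (rot a') (rot b'); case: (eqVneq c' c) => [-> //|ne].
by apply: (step c' c); lia.
Qed.

(** * Sizes of the families that enclose [F] *)

Lemma card_ord_lt (n m : nat) : m <= n -> #|[set x : 'I_n | x < m]| = m.
Proof.
move=> mn; have widen_inj : injective (widen_ord mn).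
  by move=> x y /(congr1 val) /= /val_inj.
rewrite -[RHS](card_ord m) -(card_imset _ widen_inj).
apply: eq_card => x; rewrite inE; apply/idP/imsetP => [xm|[y _ ->]].
  by exists (Ordinal xm) => //; apply: val_inj.
exact: (ltn_ord y).
Qed.

Lemma card_ord_range (n p m : nat) :
  p <= m -> m <= n -> #|[set x : 'I_n | p <= x < m]| = m - p.
Proof.
move=> pm mn; have pn := leq_trans pm mn.
rewrite -[X in X - _](card_ord_lt mn) -[X in _ - X](card_ord_lt pn).
rewrite -cardsDS; last by apply/subsetP => x; rewrite !inE => /leq_trans->.
by apply: eq_card => x; rewrite !inE -leqNgt.
Qed.

Definition triples_in (n p : nat) : {set {set 'I_n}} :=
  [set A : {set 'I_n} | A \subset [set x : 'I_n | x < p] & #|A| == 3].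

Lemma card_triples_in (n p : nat) : #|triples_in n p| <= 'C(p, 3).
Proof.
rewrite cards_draws leq_bin2l //; case: (leqP p n) => [/card_ord_lt->//|np].
by apply: leq_trans (max_card _) _; rewrite card_ord ltnW.
Qed.

Lemma triple_in (n p a b c : nat) :
  a < b -> b < c -> c < p -> triple n a b c \in ksubsets n 3 ->
  triple n a b c \in triples_in n p.
Proof.
rewrite !inE => ab bc cp ->; rewrite andbT; apply/subsetP => x; rewrite !inE.
lia.
Qed.

(** This and the next two families serve only for upper bounds, so each is the image of a product,
    whose size bounds it even where the parametrisation repeats a set. *)
Definition pair_plus (n r p m : nat) : {set {set 'I_n}} :=
  [set u.2 |: u.1 | u in setX
     [set P : {set 'I_n} | P \subset [set x : 'I_n | x < r] & #|P| == 2]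
     [set x : 'I_n | p <= x < m]].

Lemma card_pair_plus (n r p m : nat) :
  r <= n -> p <= m -> m <= n -> #|pair_plus n r p m| <= 'C(r, 2) * (m - p).
Proof.
move=> rn pm mn; apply: leq_trans (leq_imset_card _ _) _.
by rewrite cardsX cards_draws card_ord_lt // card_ord_range.
Qed.

Lemma triple_pair_plus (n r p m a b c : nat) :
  a < b -> b < r -> p <= c -> c < m -> b < n -> c < n ->
  triple n a b c \in pair_plus n r p m.
Proof.
move=> ab br pc cm bn cn; have an := ltn_trans ab bn.
apply/imsetP; exists ([set Ordinal an; Ordinal bn], Ordinal cn) => /=.
  rewrite !inE /= pc cm cards2 -val_eqE /= (ltn_eqF ab) /= !andbT.
  apply/subsetP => x; rewrite !inE -!val_eqE /=; lia.
by apply/setP => x; rewrite !inE -!val_eqE /=; lia.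
Qed.

Definition zero_plus (n r p : nat) : {set {set 'I_n}} :=
  [set triple n 0 (u.1 : 'I_n) (u.2 : 'I_n) | u in setX
     [set x : 'I_n | 1 <= x < r] [set x : 'I_n | p <= x < n]].

Lemma card_zero_plus (n r p : nat) :
  1 <= r -> r <= n -> p <= n -> #|zero_plus n r p| <= (r - 1) * (n - p).
Proof.
move=> r0 rn pn; apply: leq_trans (leq_imset_card _ _) _.
by rewrite cardsX !card_ord_range.
Qed.

Lemma triple_zero_plus (n r p b c : nat) :
  0 < b -> b < r -> p <= c -> b < n -> c < n ->
  triple n 0 b c \in zero_plus n r p.
Proof.
move=> b0 br pc bn cn; apply/imsetP.
by exists (Ordinal bn, Ordinal cn); rewrite // !inE /= b0 br pc cn.
Qed.

Definition meet_two (n : nat) : {set {set 'I_n}} :=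
  [set u.1 |: u.2 | u in setX [set x : 'I_n | x < 2]
     [set P : {set 'I_n} | #|P| == 2]].

Lemma card_meet_two (n : nat) : 2 <= n -> #|meet_two n| <= 2 * 'C(n, 2).
Proof.
move=> n2; apply: leq_trans (leq_imset_card _ _) _.
by rewrite cardsX card_ord_lt // card_draws card_ord.
Qed.

Lemma triple_meet_two (n a b c : nat) :
  a < 2 -> a < b -> b < c -> c < n -> triple n a b c \in meet_two n.
Proof.
move=> a2 ab bc cn; have bn := ltn_trans bc cn; have an := ltn_trans ab bn.
apply/imsetP; exists (Ordinal an, [set Ordinal bn; Ordinal cn]) => /=.
  by rewrite !inE /= a2 cards2 -val_eqE /= (ltn_eqF bc).
by apply/setP => x; rewrite !inE -!val_eqE.
Qed.

(** * Inequalities between binomial coefficients *)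

Lemma mul2_bin2 (m : nat) : 2 * 'C(m, 2) = m * (m - 1).
Proof. by rewrite mulnC (bin_ffact m 2) !ffactnS ffactn0 muln1 subn1. Qed.

Lemma mul6_bin3 (m : nat) : 6 * 'C(m, 3) = m * (m - 1) * (m - 2).
Proof.
by rewrite mulnC (bin_ffact m 3) !ffactnS ffactn0 muln1 mulnA subn1 subn2.
Qed.

(** For [{0, 2+i, q-i}] missing, with [q = 2s+1]: a member lies below [q-i], or it has two elements
    below [2+i] and its largest in [[q-i, n)]. *)
Lemma bin3_bound_pair (n s i : nat) :
  10 <= s -> n <= 3 * s -> 1 <= i -> i < s ->
  'C(2 * s + 1 - i, 3) + 'C(2 + i, 2) * (n - (2 * s + 1 - i))
    <= 'C(2 * s + 1, 3).
Proof.
move=> hs hn h1 h2.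
rewrite -(@leq_pmul2l 6) // mulnDr mulnA !mul6_bin3.
rewrite (_ : 6 * 'C(2 + i, 2) = 3 * ((2 + i) * (1 + i))); last first.
  by rewrite (_ : 6 = 3 * 2) // -mulnA mul2_bin2; congr (_ * (_ * _)); lia.
have : n - (2 * s + 1 - i) <= s - 1 + i by lia.
move: (n - _) => k hk.
have {hk} : 3 * ((2 + i) * (1 + i)) * k <= 3 * ((2 + i) * (1 + i)) * (s - 1 + i).
  by rewrite leq_mul2l hk orbT.
move: (_ * k) => K.
(* With slack variables for the range of [i], truncated subtraction disappears. *)
have [x ex] : exists x, i = x + 1 by exists (i - 1); lia.
have [y ey] : exists y, s = x + y + 2 by exists (s - i - 1); lia.
subst i s.
have -> : 2 * (x + y + 2) + 1 - (x + 1) = x + 2 * y + 4 by lia.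
have -> : x + 2 * y + 4 - 1 = x + 2 * y + 3 by lia.
have -> : x + 2 * y + 4 - 2 = x + 2 * y + 2 by lia.
have -> : 2 * (x + y + 2) + 1 - 1 = 2 * x + 2 * y + 4 by lia.
have -> : 2 * (x + y + 2) + 1 - 2 = 2 * x + 2 * y + 3 by lia.
have -> : x + y + 2 - 1 + (x + 1) = 2 * x + y + 2 by lia.
nia.
Qed.

(** For [{0, 4+i, q-i}] and [{1,2,q}] missing: the summands count the members below [q-i], those
    with largest element in [[q-i, q)], and those reaching [q], which contain 0. *)
Lemma bin3_bound_star (n s i : nat) :
  10 <= s -> n <= 3 * s -> 1 <= i -> i < s - 1 ->
  'C(2 * s + 1 - i, 3) + 'C(4 + i, 2) * i + (3 + i) * (n - (2 * s + 1))
    <= 'C(2 * s + 1, 3).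
Proof.
move=> hs hn h1 h2.
have : (3 + i) * (n - (2 * s + 1)) <= (3 + i) * (s - 1).
  by rewrite leq_mul2l; apply/orP; right; lia.
move: (_ * (n - _)) => K.
rewrite -(@leq_pmul2l 6 (_ + _)) // !(mulnDr 6) !(mulnA 6) !mul6_bin3.
rewrite (_ : 6 * 'C(4 + i, 2) = 3 * ((4 + i) * (3 + i))); last first.
  by rewrite (_ : 6 = 3 * 2) // -mulnA mul2_bin2; congr (_ * (_ * _)); lia.
have [x ex] : exists x, i = x + 1 by exists (i - 1); lia.
have [y ey] : exists y, s = x + y + 3 by exists (s - i - 2); lia.
subst i s.
have -> : 2 * (x + y + 3) + 1 - (x + 1) = x + 2 * y + 6 by lia.
have -> : x + 2 * y + 6 - 1 = x + 2 * y + 5 by lia.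
have -> : x + 2 * y + 6 - 2 = x + 2 * y + 4 by lia.
have -> : 2 * (x + y + 3) + 1 - 1 = 2 * x + 2 * y + 6 by lia.
have -> : 2 * (x + y + 3) + 1 - 2 = 2 * x + 2 * y + 5 by lia.
have -> : x + y + 3 - 1 = x + y + 2 by lia.
(* The difference of the two sides has nonnegative coefficients in [x], [y] except for the constant
   -18. [M] is its nonlinear part, and [17 * x + 42 * y] absorbs the constant because
   [x + y >= 7]. *)
have [M eM] : exists M,
    (2 * (x + y + 3) + 1) * (2 * x + 2 * y + 6) * (2 * x + 2 * y + 5) + 18 =
    (x + 2 * y + 6) * (x + 2 * y + 5) * (x + 2 * y + 4)
    + 3 * ((4 + (x + 1)) * (3 + (x + 1))) * (x + 1)
    + 6 * ((3 + (x + 1)) * (x + y + 2)) + (M + 17 * x + 42 * y).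
  exists (4 * x ^ 3 + 18 * x ^ 2 * y + 12 * x * y ^ 2 + 21 * x ^ 2 + 78 * x * y
          + 12 * y ^ 2); lia.
lia.
Qed.

Lemma bin3_bound_two (n s : nat) :
  10 <= s -> n <= 3 * s -> 2 * 'C(n, 2) <= 'C(2 * s + 1, 3).
Proof.
move=> hs hn; apply: (@leq_trans (2 * 'C(3 * s, 2))).
  by rewrite leq_mul2l leq_bin2l.
rewrite mul2_bin2 -(@leq_pmul2l 6) // mul6_bin3.
have [y ->] : exists y, s = y + 10 by exists (s - 10); lia.
have -> : 3 * (y + 10) - 1 = 3 * y + 29 by lia.
have -> : 2 * (y + 10) + 1 - 1 = 2 * y + 20 by lia.
have -> : 2 * (y + 10) + 1 - 2 = 2 * y + 19 by lia.
nia.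
Qed.

(** * The bound for shifted families *)

(** The interval [[0, q]] has [q + 1] points, one more than [s] members may cover. *)
Lemma not_cover (n s q : nat) (F : {set {set 'I_n}}) (G : 'I_s -> {set 'I_n}) :
  propertyU F s q -> q < n -> (forall i, G i \in F) ->
  exists2 x : 'I_n, x <= q & forall i, x \notin G i.
Proof.
move=> FU qn GF; case: (boolP [exists x : 'I_n, (x <= q) && [forall i, x \notin G i]]).
  by case/existsP => x /andP[xq /forallP]; exists x.
rewrite negb_exists => /forallP H; exfalso.
have : q < #|\bigcup_i G i|; last by rewrite ltnNge FU.
rewrite -[X in X <= _](card_ord_lt qn); apply/subset_leq_card/subsetP => x.
rewrite inE ltnS => xq; move: (H x); rewrite xq negb_forall => /existsP[i].
by rewrite negbK => xG; apply/bigcupP; exists i.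
Qed.

Lemma shifted_bound (n s : nat) (F : {set {set 'I_n}}) :
  10 <= s -> n <= 3 * s -> F \subset ksubsets n 3 ->
  propertyU F s (2 * s + 1) -> shifted F -> #|F| <= 'C(2 * s + 1, 3).
Proof.
move=> s10 ns F3 FU sF.
have FE A : A \in F -> exists a b c,
    [/\ a < b, b < c, c < n, A = triple n a b c & A \in ksubsets n 3].
  move=> AF; have A3 := subsetP F3 A AF.
  by have [a [b [c [ab bc cn eA]]]] := ksubsets3P A3; exists a, b, c; split.
(* A member that dominates a missing triple entrywise would force that triple into [F] by
   shifting. *)
have out a b c a' b' c' : a < b -> b < c -> c < n -> triple n a b c \in F ->
    a' < b' -> b' < c' -> triple n a' b' c' \notin F ->
    [|| a < a', b < b' | c < c'].
  move=> ab bc cn abcF ab' bc' NF; apply: contraNT NF.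
  rewrite !negb_or -!leqNgt => /and3P[? ? ?].
  exact: (shifted_triple sF abcF).
set q := 2 * s + 1.
case: (boolP (triple n 0 1 q \in F)) => F01q; last first.
  apply: leq_trans (card_triples_in n q); apply/subset_leq_card/subsetP => A AF.
  have [a [b [c [ab bc cn eA A3]]]] := FE A AF; rewrite eA in AF A3 *.
  by apply: triple_in => //; have := out _ _ _ _ _ _ ab bc cn AF _ _ F01q; lia.
(* Otherwise the entry [q] drops out of [triple n 0 1 q], leaving at most two elements. *)
have qn : q < n.
  have := subsetP F3 _ F01q; rewrite inE => /eqP c3; rewrite ltnNge; apply/negP => nq.
  have : #|triple n 0 1 q| <= 2; last by rewrite c3.
  have n2 : 2 <= n by rewrite -[n]card_ord -ltnS -c3 ltnW // ltnS max_card.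
  rewrite -[X in _ <= X](card_ord_lt n2); apply/subset_leq_card/subsetP => x.
  by rewrite !inE; have := ltn_ord x; lia.
case: (boolP (triple n 1 2 q \in F)) => F12q.
  pose G (l : 'I_s) := if l == 0 :> nat then triple n 1 2 q
                       else triple n 0 (2 + l) (q - l).
  have [i i0 Fi] : exists2 i : 'I_s, 0 < i & triple n 0 (2 + i) (q - i) \notin F.
    case: (boolP [exists i : 'I_s, (0 < i) && (triple n 0 (2 + i) (q - i) \notin F)]).
      by case/existsP => i /andP[]; exists i.
    rewrite negb_exists => /forallP H.
    have GF l : G l \in F.
      rewrite /G; case: ifPn => // l0; move: (H l); rewrite lt0n l0 /=.
      by rewrite negbK.
    have [x xq xG] := not_cover FU qn GF.
    have s0 : 0 < s by lia.
    have s1 : 1 < s by lia.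
    have := xG (Ordinal s0); rewrite /G /= inE => x0.
    have := xG (Ordinal s1); rewrite /G /= inE => x1.
    (* The middle entries [2+l] run over [3..s+1] and the last ones [q-l] over [s+2..q-1]; the rest
       of [[0, q]] is [0] and [{1,2,q}]. *)
    case: (leqP x (s + 1)) => xs.
      have ls : x - 2 < s by lia.
      have := xG (Ordinal ls); rewrite /G /=; case: ifP; rewrite inE; lia.
    have ls : q - x < s by lia.
    have := xG (Ordinal ls); rewrite /G /=; case: ifP; rewrite inE; lia.
  have lt_i := ltn_ord i.
  apply: leq_trans (bin3_bound_pair s10 ns i0 lt_i).
  apply: (@leq_trans #|triples_in n (q - i) :|: pair_plus n (2 + i) (q - i) n|).
    apply/subset_leq_card/subsetP => A AF; rewrite in_setU.
    have [a [b [c [ab bc cn eA A3]]]] := FE A AF; rewrite eA in AF A3 *.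
    case: (ltnP c (q - i)) => cq; first by rewrite triple_in.
    rewrite triple_pair_plus ?orbT //; last lia.
    by have := out _ _ _ _ _ _ ab bc cn AF _ _ Fi; lia.
  rewrite cardsU; apply: leq_trans (leq_subr _ _) _.
  by apply: leq_add; [exact: card_triples_in | apply: card_pair_plus; lia].
case: (boolP (triple n 2 3 4 \in F)) => F234; last first.
  apply: leq_trans (bin3_bound_two s10 ns).
  apply: leq_trans (card_meet_two _); last lia.
  apply/subset_leq_card/subsetP => A AF.
  have [a [b [c [ab bc cn eA A3]]]] := FE A AF; rewrite eA in AF A3 *.
  apply: triple_meet_two => //.
  by have := out _ _ _ _ _ _ ab bc cn AF _ _ F234; lia.
pose G (l : 'I_s) := if l == 0 :> nat then triple n 0 1 q
                     else if l == s - 1 :> nat then triple n 2 3 4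
                     else triple n 0 (4 + l) (q - l).
have [i /andP[i0 lt_i] Fi] : exists2 i : 'I_s, 0 < i < s - 1 &
    triple n 0 (4 + i) (q - i) \notin F.
  case: (boolP [exists i : 'I_s, (0 < i < s - 1) &&
                  (triple n 0 (4 + i) (q - i) \notin F)]).
    by case/existsP => i /andP[]; exists i.
  rewrite negb_exists => /forallP H.
  have GF l : G l \in F.
    rewrite /G; case: ifPn => // l0; case: ifPn => // l1; move: (H l).
    have ls := ltn_ord l.
    have -> : 0 < l < s - 1 by lia.
    by rewrite /= negbK.
  have [x xq xG] := not_cover FU qn GF.
  have s0 : 0 < s by lia.
  have s1 : s - 1 < s by lia.
  have := xG (Ordinal s0); rewrite /G /= inE => x0.
  have := xG (Ordinal s1); rewrite /G /= eqxx; case: ifP; first lia.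
  move=> _; rewrite inE => x1.
  (* For [0 < l < s-1] the entries [4+l] fill [5..s+2] and [q-l] fill [s+3..q-1]; the two special
     triples supply [0..4] and [q]. *)
  case: (leqP x (s + 2)) => xs.
    have ls : x - 4 < s by lia.
    have := xG (Ordinal ls); rewrite /G /=; do 2?case: ifP; rewrite inE; lia.
  have ls : q - x < s by lia.
  have := xG (Ordinal ls); rewrite /G /=; do 2?case: ifP; rewrite inE; lia.
apply: leq_trans (bin3_bound_star s10 ns i0 lt_i).
apply: (@leq_trans #|triples_in n (q - i) :|: pair_plus n (4 + i) (q - i) q
                     :|: zero_plus n (4 + i) q|).
  apply/subset_leq_card/subsetP => A AF; rewrite !in_setU.
  have [a [b [c [ab bc cn eA A3]]]] := FE A AF; rewrite eA in AF A3 *.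
  case: (ltnP c (q - i)) => cq; first by rewrite triple_in.
  have bi : b < 4 + i by have := out _ _ _ _ _ _ ab bc cn AF _ _ Fi; lia.
  have bn := ltn_trans bc cn.
  case: (ltnP c q) => cq'; first by rewrite triple_pair_plus ?orbT.
  (* With [a > 0] and [c >= q] the member would dominate [{1,2,q}]. *)
  have a0 : a = 0 by have := out _ _ _ _ _ _ ab bc cn AF _ _ F12q; lia.
  by rewrite a0 triple_zero_plus ?orbT //; lia.
rewrite cardsU; apply: leq_trans (leq_subr _ _) _; apply: leq_add.
  rewrite cardsU; apply: leq_trans (leq_subr _ _) _.
  apply: leq_add; first exact: card_triples_in.
  rewrite -[X in _ * X](_ : q - (q - i) = i); last lia.
  by apply: card_pair_plus; lia.
rewrite -[3 + i](_ : 4 + i - 1 = 3 + i); last lia.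
by apply: card_zero_plus; lia.
Qed.

Theorem theorem7 (n s : nat) (F : {set {set 'I_n}}) :
  10 <= s -> n <= 3 * s ->
  F \subset ksubsets n 3 ->
  propertyU F s (2 * s + 1) ->
  #|F| <= 'C(2 * s + 1, 3).
Proof.
move=> s10 ns F3 FU; have [F' [F'3 F'U sF' <-]] := shifted_reduction F3 FU.
exact: shifted_bound.
Qed.
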